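(* Let $f_1, f_2, \dots, f_s$ be points of $\mathbb{R}^d$ such that none of them lies in the convex hull of the others, and let $Q = \mathrm{conv}\{f_1, f_2, \dots, f_s\}$. Then $$\mathrm{ri}(Q) = \Big\{\lambda_1 f_1 + \lambda_2 f_2 + \dots + \lambda_s f_s \ :\ \sum_{j=1}^s \lambda_j = 1,\ \lambda_j > 0 \text{ for } j = 1, \dots, s\Big\}.$$
   Context: $\mathrm{conv}(M)$ denotes the convex hull of $M \subset \mathbb{R}^d$. For a nonempty set $M \subset \mathbb{R}^d$, $\mathrm{Aff}(M)$ denotes its affine hull, i.e. the set of all finite combinations $\sum_i \mu_i z_i$ with $z_i \in M$, $\mu_i \in \mathbb{R}$, $\sum_i \mu_i = 1$. The relative interior $\mathrm{ri}(M)$ is the interior of $M$ as a subset of $\mathrm{Aff}(M)$, where $\mathrm{Aff}(M)$ carries the metric induced from the $\ell_1$ norm on $\mathbb{R}^d$ (equivalently, from any norm). *)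

(* Defs.v *)
From HB Require Import structures.
From mathcomp Require Import all_boot all_order all_algebra.
From mathcomp Require Import boolp classical_sets reals topology normedtype convex.
Set Implicit Arguments.
Unset Strict Implicit.
Unset Printing Implicit Defensive.
Import Order.TTheory GRing.Theory Num.Theory.
Import numFieldNormedType.Exports.
Local Open Scope classical_set_scope.
Local Open Scope ring_scope.

Definition convex_hull (R : realType) (V : lmodType R) (M : set V) : set V :=
  smallest (@convex_set R V) M.

(* Only meaningful for nonempty M: the value at set0 is set0. *)
Definition affine_hull (R : realType) (V : lmodType R) (M : set V) : set V :=
  [set x | exists n (mu : 'I_n -> R) (z : 'I_n -> V),
    [/\ forall i, M (z i), \sum_i mu i = 1 & x = \sum_i mu i *: z i]].

(* The library topology of 'rV[R]_d is the one of the sup norm, which is also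
   that of the l1 norm; relative_interiorP below gives the l1 description. *)
Definition relative_interior (R : realType) (d : nat) (M : set 'rV[R]_d) :
  set 'rV[R]_d := (M : set (subspace (affine_hull M)))°.

Lemma sub_affine_hull (R : realType) (V : lmodType R) (M : set V) :
  M `<=` affine_hull M.
Proof.
move=> x Mx; exists 1%N, (fun=> 1), (fun=> x).
by split; rewrite ?big_ord1 ?scale1r.
Qed.

Lemma relative_interiorP (R : realType) (d : nat) (M : set 'rV[R]_d)
    (x : 'rV[R]_d) :
  relative_interior M x <->
  affine_hull M x /\ exists2 e : R, 0 < e &
    forall y, affine_hull M y -> \sum_i `|x ord0 i - y ord0 i| < e -> M y.
Proof.
have nbhsE : affine_hull M x ->
    relative_interior M x = within (affine_hull M) (nbhs x) M.
  by move=> Ax; rewrite (nbhs_subspace_in Ax).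
split.
- move=> xM; have Ax : affine_hull M x by exact: (sub_affine_hull (nbhs_singleton xM)).
  split=> //; move: xM.
  rewrite nbhsE// /within/= => /nbhs_ballP[e /= e0 eM]; exists e => // y Ay xye.
  apply: eM => //; split=> // i j; rewrite (ord1 i).
  apply: le_lt_trans xye; rewrite (bigD1 j)//= lerDl; exact: sumr_ge0.
- move=> [Ax [e e0 eM]]; rewrite nbhsE//.
  have d0 : 0 < d.+1%:R :> R by rewrite ltr0n.
  apply/nbhs_ballP; exists (e / d.+1%:R); first exact: divr_gt0.
  move=> y [_ xy] Ay; apply: eM => //.
  apply: (@le_lt_trans _ _ (\sum_(i < d) e / d.+1%:R)).
    by apply: ler_sum => i _; apply: ltW; exact: xy.
  rewrite sumr_const card_ord -[ltLHS]mulr_natr -mulrA gtr_pMr//.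
  by rewrite mulrC ltr_pdivrMr// mul1r ltr_nat.
Qed.

(* Main.v *)
Require Import Defs.
From HB Require Import structures.
From mathcomp Require Import all_boot all_order all_algebra.
From mathcomp Require Import boolp classical_sets reals topology normedtype convex.
From mathcomp Require Import interval_inference ring.
Import Order.TTheory GRing.Theory Num.Theory.
Import numFieldNormedType.Exports.
Local Open Scope classical_set_scope.
Local Open Scope ring_scope.

(** The convex hull [Q] of the [f j] consists of their convex combinations, and
    its affine hull of their affine combinations.

    Points with positive weights are interior because weights can be chosen to
    depend Lipschitz-continuously on the point: if [x] has weights [lambda],
    all positive, and [y] is in the affine hull, then [y - x] is a combination
    of the [f j] whose coefficients sum to zero and are bounded by
    [K * sum_i |x_i - y_i|], for a constant [K] that depends only on [f]
    ([zero_sum_coefficients_bound]).  Adding them to [lambda] gives weights for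
    [y], and these stay nonnegative when [y] is near [x].  The bound comes from
    a generalized inverse of the matrix whose rows are the vectors [(f j, 1)];
    with this last coordinate, affine combinations of points become linear
    combinations of vectors.

    Conversely let [x] be a relative interior point, and let [b] be the
    barycentre of the [f j], whose weights [1/s] are all positive.  The segment
    from [b] to [x] can be prolonged slightly beyond [x] to a point [y] of [Q].
    Then [x] is a convex combination of [y], with nonnegative weights, and of
    [b], with a positive coefficient on [b]: hence all the resulting weights of
    [x] are positive. *)

Lemma convex_setD {R : realType} {V : lmodType R} (C : set V) (x y : V) (t : R) :
  convex_set C -> C x -> C y -> 0 <= t -> t <= 1 -> C (t *: x + (1 - t) *: y).
Proof.
move=> cC Cx Cy t0 t1.
have := cC x y (Itv01 t0 t1); rewrite !inE; exact.
Qed.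

(** Convexity allows only binary combinations, so the first point is split off
    and the other weights are divided by their sum; when that sum vanishes the
    combination is the first point itself. *)
Lemma convex_set_sum {R : realType} {V : lmodType R} (C : set V) (n : nat)
    (f : 'I_n -> V) (lambda : 'I_n -> R) :
  convex_set C -> (forall i, C (f i)) -> (forall i, 0 <= lambda i) ->
  \sum_i lambda i = 1 -> C (\sum_i lambda i *: f i).
Proof.
move=> cC; elim: n f lambda => [|n IHn] f lambda Cf l0.
  by rewrite big_ord0 => /esym/eqP; rewrite oner_eq0.
rewrite !big_ord_recl => l1.
have restE : \sum_(i < n) lambda (lift ord0 i) = 1 - lambda ord0.
  by rewrite -l1 addrAC subrr add0r.
have rest0 : 0 <= 1 - lambda ord0 by rewrite -restE sumr_ge0.
have [rest_eq0|rest_neq0] := eqVneq (1 - lambda ord0) 0.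
  have lz i : lambda (lift ord0 i) = 0.
    move/eqP: restE; rewrite rest_eq0 psumr_eq0// => /allP/(_ i).
    by rewrite mem_index_enum => /(_ isT)/eqP.
  rewrite big1 => [|i _]; last by rewrite lz scale0r.
  by move/subr0_eq: rest_eq0 => <-; rewrite scale1r addr0.
set u := 1 - lambda ord0 in restE rest0 rest_neq0 *.
have -> : \sum_(i < n) lambda (lift ord0 i) *: f (lift ord0 i) =
    u *: \sum_(i < n) (lambda (lift ord0 i) / u) *: f (lift ord0 i).
  rewrite scaler_sumr; apply: eq_bigr => i _.
  by rewrite scalerA mulrCA divff// mulr1.
apply: convex_setD => //; last by rewrite -subr_ge0.
apply: IHn => // [i|]; first by rewrite divr_ge0.
by rewrite -mulr_suml restE divff.
Qed.

(** Turns membership in a hull, defined from outside as an intersection of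
    convex sets, into the existence of weights: convex combinations themselves
    form a convex set, and any convex set is closed under them. *)
Lemma convex_hull_range {R : realType} {V : lmodType R} {n : nat}
    (f : 'I_n -> V) :
  convex_hull (range f) =
  [set x | exists lambda : 'I_n -> R,
     [/\ \sum_j lambda j = 1, forall j, 0 <= lambda j &
         x = \sum_j lambda j *: f j]].
Proof.
apply/seteqP; split=> [|_ [lambda [l1 l0 ->]]].
- apply: smallest_sub => [x y t|_ [i _ <-]].
  + rewrite !inE => -[l [l1 l0 ->]] [m [m1 m0 ->]].
    exists (fun j => t%:num * l j + (1 - t%:num) * m j); split.
    * by rewrite big_split -!mulr_sumr/= l1 m1 !mulr1 addrC subrK.
    * by move=> j; rewrite addr_ge0// mulr_ge0// subr_ge0.
    * rewrite /conv/= !scaler_sumr -big_split; apply: eq_bigr => j _ /=.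
      by rewrite [RHS]scalerDl !scalerA.
  + exists (fun j => (j == i)%:R); split.
    * by rewrite (bigD1 i)//= eqxx big1 ?addr0// => j /negPf ->.
    * by move=> j; rewrite ler0n.
    * rewrite (bigD1 i)//= eqxx scale1r big1 ?addr0// => j /negPf ->.
      by rewrite scale0r.
- move=> C [cC fC]; apply: convex_set_sum => // i.
  by apply: fC; exists i.
Qed.

(** Affine combinations of affine combinations are affine combinations.  It is
    meant for the convex hull of the [f j] as [M], whence the hypothesis. *)
Lemma affine_hull_combination {R : realType} {V : lmodType R} {s : nat}
    (f : 'I_s -> V) (M : set V) (y : V) :
  (forall x, M x -> exists lambda : 'I_s -> R,
     \sum_j lambda j = 1 /\ x = \sum_j lambda j *: f j) ->
  affine_hull M y ->
  exists mu : 'I_s -> R, \sum_j mu j = 1 /\ y = \sum_j mu j *: f j.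
Proof.
move=> Mf [n [mu [z [Mz mu1 ->]]]].
have /choice[l lP] i := Mf _ (Mz i).
exists (fun j => \sum_i mu i * l i j); split.
  rewrite exchange_big -[RHS]mu1; apply: eq_bigr => i _ /=.
  by rewrite -mulr_sumr (lP i).1 mulr1.
under [RHS]eq_bigr do rewrite scaler_suml.
rewrite exchange_big; apply: eq_bigr => i _ /=.
rewrite {1}(lP i).2 scaler_sumr; apply: eq_bigr => j _.
by rewrite scalerA.
Qed.

(** The appended column of ones turns the condition on the sum of the
    coefficients into one more coordinate of a linear system
    ([mul_homogeneous_mx]). *)
Definition homogeneous_mx {R : realType} {d s : nat} (f : 'I_s -> 'rV[R]_d) :
    'M[R]_(s, d + 1) :=
  row_mx (\matrix_j f j) (const_mx 1).

Lemma mul_homogeneous_mx {R : realType} {d s : nat} (f : 'I_s -> 'rV[R]_d)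
    (c : 'rV[R]_s) :
  c *m homogeneous_mx f =
  row_mx (\sum_j c ord0 j *: f j) (const_mx (\sum_j c ord0 j)).
Proof.
rewrite mul_mx_row; congr row_mx.
  by rewrite mulmx_sum_row; apply: eq_bigr => j _; rewrite rowK.
by apply/rowP => i; rewrite !mxE; apply: eq_bigr => j _; rewrite mxE mulr1.
Qed.

(** The given coefficients may be arbitrarily large compared with the vector that
    they represent, since the [f j] may be affinely dependent; they are replaced
    by others that are controlled by that vector.  If [A] is the homogeneous
    matrix and [w] is in its row space, then [w *m pinvmx A] is a solution [c']
    of [c' *m A = w] that is linear in [w], hence bounded by a multiple of [w]. *)
Lemma zero_sum_coefficients_bound {R : realType} {d s : nat}
    (f : 'I_s -> 'rV[R]_d) :
  exists2 K : R, 0 <= K & forall c : 'I_s -> R, \sum_j c j = 0 ->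
    exists c' : 'I_s -> R,
      [/\ \sum_j c' j = 0, \sum_j c' j *: f j = \sum_j c j *: f j &
          forall j, `|c' j| <= K * \sum_i `|(\sum_j c j *: f j) ord0 i|].
Proof.
pose P := pinvmx (homogeneous_mx f).
exists (\sum_i \sum_j `|P i j|) => [|c c0].
  by apply: sumr_ge0 => i _; apply: sumr_ge0.
set v := \sum_j c j *: f j.
pose w : 'rV_(d + 1) := row_mx v (const_mx 0).
have wE : w = \row_j c j *m homogeneous_mx f.
  rewrite mul_homogeneous_mx; congr (row_mx _ (const_mx _)).
    by apply: eq_bigr => j _; rewrite mxE.
  by rewrite -[LHS]c0; apply: eq_bigr => j _; rewrite mxE.
have : w *m P *m homogeneous_mx f = w.
  by apply: mulmxKpV; rewrite wE submxMl.
rewrite mul_homogeneous_mx => /eq_row_mx[sumf /rowP/(_ ord0)].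
rewrite !mxE => sum0.
exists (fun j => (w *m P) ord0 j); split=> // j.
rewrite mxE big_split_ord/= [X in _ + X]big1 ?addr0 => [|i _]; last first.
  by rewrite row_mxEr mxE mul0r.
rewrite mulr_sumr; apply: le_trans (ler_norm_sum _ _ _) _.
apply: ler_sum => i _; rewrite row_mxEl normrM mulrC.
apply: ler_wpM2r => //.
rewrite (bigD1 (lshift 1 i))//= (bigD1 j)//= -addrA lerDl.
by rewrite addr_ge0// ?sumr_ge0// => k _; rewrite sumr_ge0.
Qed.

Theorem theorem3p1 (R : realType) (d s : nat) (f : 'I_s -> 'rV[R]_d)
  (s_gt0 : (0 < s)%N)
  (f_not_in_hull : forall i : 'I_s, ~ convex_hull [set f j | j in [set j | j != i]] (f i)) :
  relative_interior (convex_hull (range f)) =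
  [set x | exists lambda : 'I_s -> R,
     [/\ \sum_(j < s) lambda j = 1,
         forall j : 'I_s, 0 < lambda j &
         x = \sum_(j < s) lambda j *: f j]].
Proof.
apply/seteqP; split=> x.
- move=> xQ; have /relative_interiorP[_ [e e0 eQ]] := xQ.
  have {xQ} Qx : convex_hull (range f) x by exact: nbhs_singleton xQ.
  have s0 : 0 < s%:R :> R by rewrite ltr0n.
  have sum_s : \sum_(j < s) s%:R^-1 = 1 :> R.
    by rewrite sumr_const card_ord -[LHS]mulr_natr mulVf// gt_eqF.
  pose b : 'rV[R]_d := \sum_j s%:R^-1 *: f j.
  have Qb : convex_hull (range f) b.
    by rewrite convex_hull_range; exists (fun=> s%:R^-1); split=> // j; rewrite invr_ge0 ltW.
  pose N := \sum_i `|x ord0 i - b ord0 i|.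
  have N0 : 0 <= N by exact: sumr_ge0.
  (* The point [y] below is at distance [t * N] from [x]; the [+ 1] makes this
     smaller than [e] and covers the case [x = b]. *)
  pose t := e / (N + 1).
  have t0 : 0 < t by rewrite divr_gt0// ltr_wpDl.
  have t1 : 0 < 1 + t by rewrite ltr_wpDl.
  pose y := (1 + t) *: x - t *: b.
  have : convex_hull (range f) y.
    apply: eQ.
      exists 2%N, (fun i => if i == ord0 then 1 + t else - t),
        (fun i => if i == ord0 then x else b); split.
      + by move=> i; case: ifP.
      + by rewrite !big_ord_recl big_ord0/= addr0 addrK.
      + by rewrite !big_ord_recl big_ord0/= addr0 scaleNr.
    rewrite (eq_bigr (fun i => t * `|x ord0 i - b ord0 i|)) => [|i _]; last first.
      have -> : x ord0 i - y ord0 i = - (t * (x ord0 i - b ord0 i)).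
        by rewrite /y !mxE; ring.
      by rewrite normrN normrM gtr0_norm.
    by rewrite -mulr_sumr -/N mulrAC -mulrA gtr_pMr// ltr_pdivrMr ?mul1r ?ltrDl// ltr_wpDl.
  rewrite convex_hull_range => -[mu [mu1 mu0 yE]].
  (* Solve [y = (1 + t) *: x - t *: b] for [x]. *)
  exists (fun j => (1 + t)^-1 * (mu j + t / s%:R)); split.
  + by rewrite -mulr_sumr big_split/= mu1 -mulr_sumr sum_s mulr1 mulVf// gt_eqF.
  + by move=> j; rewrite mulr_gt0 ?invr_gt0// ltr_wpDl// divr_gt0.
  + under eq_bigr do rewrite -scalerA scalerDl -scalerA.
    rewrite -scaler_sumr big_split/= -yE -scaler_sumr -/b /y subrK scalerA.
    by rewrite mulVf ?scale1r// gt_eqF.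
- move=> [lambda [l1 l0 xE]].
  have Qx : convex_hull (range f) x.
    by rewrite convex_hull_range; exists lambda; split=> // j; exact/ltW.
  have [K K0 boundK] := zero_sum_coefficients_bound f.
  have K1 : 0 < K + 1 by rewrite ltr_wpDl.
  pose i0 := Ordinal s_gt0.
  pose m := lambda [arg min_(i < i0) lambda i]%O.
  have lem j : m <= lambda j.
    by rewrite /m; case: arg_minP => // i _; exact.
  apply/relative_interiorP; split; first exact: sub_affine_hull.
  (* Within this radius the corrections are at most [m], the least weight;
     [+ 1] allows for [K = 0]. *)
  exists (m / (K + 1)); first exact: divr_gt0 (l0 _) K1.
  move=> y /(affine_hull_combination f)[z|mu [mu1 yE] xy].
    by rewrite convex_hull_range => -[l [? _ ?]]; exists l; split.
  have vE : \sum_j (mu j - lambda j) *: f j = y - x.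
    by under eq_bigr do rewrite scalerBl; rewrite sumrB -xE -yE.
  have [|c [c0 cE cK]] := boundK (fun j => mu j - lambda j).
    by rewrite sumrB mu1 l1 subrr.
  rewrite convex_hull_range; exists (fun j => lambda j + c j); split.
  + by rewrite big_split/= l1 c0 addr0.
  + move=> j; rewrite -lerBlDr sub0r; apply: le_trans (lem j).
    apply: le_trans (ler_norm _) _; rewrite normrN.
    apply: le_trans (cK j) _; rewrite vE.
    under eq_bigr do rewrite !mxE distrC.
    move: xy; rewrite ltr_pdivlMr// => /ltW; apply: le_trans.
    by rewrite mulrC ler_wpM2l ?sumr_ge0// lerDl.
  + under eq_bigr do rewrite scalerDl.
    by rewrite big_split/= cE vE -xE addrC subrK.
Qed.
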